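(* Let $w_n(a)=w_n(a,b,c,d)$, $n\ge0$, be the moments of the Wilson polynomials. Then, as formal power series in $t$, $$\sum_{n=0}^\infty w_n(0)\frac{t^{2n}}{(2n)!}={}_3F_2\left(\begin{array}{c}b,\ c,\ d\\ b+c+d,\ \frac{1}{2}\end{array};\sin^2\frac{t}{2}\right)$$ and $$\sum_{n=0}^\infty w_n(1/2)\frac{t^{2n+1}}{(2n+1)!}=2\sin\frac{t}{2}\;{}_3F_2\left(\begin{array}{c}b+\frac12,\ c+\frac12,\ d+\frac12\\ b+c+d+\frac12,\ \frac{3}{2}\end{array};\sin^2\frac{t}{2}\right).$$
   Context: ${}_{r}F_{s}$ denotes the generalized hypergeometric series. The moments $w_n(a)=w_n(a,b,c,d)$ of the Wilson polynomials are defined (e.g. for $a,b,c,d>0$) by $$\frac{1}{2\pi}\int_0^\infty\left|\frac{\Gamma(a+ix)\Gamma(b+ix)\Gamma(c+ix)\Gamma(d+ix)}{\Gamma(2ix)}\right|^2x^{2n}dx=w_{n}(a)\frac{\Gamma(a+b)\Gamma(a+c)\Gamma(a+d)\Gamma(b+c)\Gamma(b+d)\Gamma(c+d)}{\Gamma(a+b+c+d)}.$$ They satisfy $w_0(a)=1$ and $w_{n+1}(a)=\frac{(a+b)(a+c)(a+d)}{a+b+c+d}\,w_n(a+1)-a^2w_n(a)$ for $n\ge0$ (where $w_n(a+1)=w_n(a+1,b,c,d)$). In general $w_n(a,b,c,d)$ is understood as the rational function of the indeterminates $a,b,c,d$ determined by this initial value and recurrence; $w_n(0)$ and $w_n(1/2)$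 are its values at $a=0$ and $a=1/2$. *)

(* Defs.v *)
From HB Require Import structures.
From mathcomp Require Import all_boot all_order all_algebra.
From mathcomp Require Import mpoly.

Set Implicit Arguments.
Unset Strict Implicit.
Unset Printing Implicit Defensive.

Import GRing.Theory.
Local Open Scope ring_scope.

Section RationalFunctions.

Variable L : fieldType.
Implicit Types (f : {fraction {poly L}}) (x : L) (p q : {poly L}).

(* f(a + c); see ratf_shiftE for the independence of the representative. *)
Definition ratf_shift f (c : L) : {fraction {poly L}} :=
  let r := repr f in
  tofrac (\n_r \Po ('X + c%:P)) / tofrac (\d_r \Po ('X + c%:P)).

(* The representative of a fraction need not be in lowest terms, hence the
   division by the gcd: otherwise the denominator could vanish at a point where
   f is regular (see ratf_valueE). The value at a genuine pole is the junk value 0. *)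
Definition ratf_value f x : L :=
  let r := repr f in
  let g := gcdp \n_r \d_r in
  (\n_r %/ g).[x] / (\d_r %/ g).[x].

Lemma ratf_repr p q : q != 0 ->
  let r := repr (tofrac p / tofrac q : {fraction {poly L}}) in
  p * \d_r = q * \n_r.
Proof.
move=> q0 r; have d0 : \d_r != 0 by [].
have E : tofrac \d_r * (tofrac p / tofrac q) = tofrac \n_r :> {fraction {poly L}}.
  rewrite -[X in _ * X]reprK -/r; unlock tofrac.
  rewrite -[LHS]FracField.pi_mul; apply/eqmodP.
  rewrite /= FracField.equivfE /FracField.mulf !numden_Ratio ?mul1r ?mulf_neq0 ?oner_eq0 //.
  by rewrite mulr1 mulrC.
apply/eqP; rewrite -tofrac_eq !tofracM -E mulrCA [tofrac q * _]mulrC.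
by rewrite divfK ?tofrac_eq0 // mulrC.
Qed.

Lemma ratf_shiftE p q c : q != 0 ->
  ratf_shift (tofrac p / tofrac q) c
    = tofrac (p \Po ('X + c%:P)) / tofrac (q \Po ('X + c%:P)).
Proof.
move=> q0; have := ratf_repr p q0; rewrite /ratf_shift /=.
set r := repr _ => E; have d0 : \d_r != 0 by [].
have nz (s : {poly L}) : s != 0 -> s \Po ('X + c%:P) != 0.
  by rewrite comp_poly_eq0 // size_XaddC.
apply/eqP; rewrite eqr_div ?tofrac_eq0 ?nz //.
by rewrite -!tofracM; apply/eqP; congr (tofrac _); rewrite -!comp_polyM E mulrC.
Qed.

Lemma ratf_valueE p q x : q.[x] != 0 ->
  ratf_value (tofrac p / tofrac q) x = p.[x] / q.[x].
Proof.
move=> qx; have q0 : q != 0 by apply: contra_neq qx => ->; rewrite horner0.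
have := ratf_repr p q0; rewrite /ratf_value /=.
set r := repr _; set n := \n_r; set d := \d_r; set g := gcdp n d => E.
have d0 : d != 0 by exact: denom_ratioP.
have g0 : g != 0 by rewrite gcdp_eq0 negb_and d0 orbT.
have nE : n = n %/ g * g by rewrite divpK ?dvdp_gcdl.
have dE : d = d %/ g * g by rewrite divpK ?dvdp_gcdr.
have E' : p * (d %/ g) = q * (n %/ g).
  by apply: (mulIf g0); rewrite -!mulrA -nE -dE.
have dvd : d %/ g %| q.
  have cop : coprimep (d %/ g) (n %/ g).
    by rewrite coprimep_sym coprimep_div_gcd // d0 orbT.
  by rewrite -(Gauss_dvdpl _ cop) -E' dvdp_mull.
have dx : (d %/ g).[x] != 0.
  apply: contra_neq qx => dx.
  by case/dvdpP: dvd => s ->; rewrite hornerM dx mulr0.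
by apply/eqP; rewrite eqr_div // -!hornerM E' mulrC.
Qed.

End RationalFunctions.

(* w_n(a, b, c, d) as an element of L(a). When b, c, d are the indeterminates of
   L = k(b, c, d), this is the rational function in k(a, b, c, d) = L(a)
   determined by w_0 = 1 and the contiguity recurrence in a. *)
Fixpoint wilson_moment (L : fieldType) (b c d : L) (n : nat) :
    {fraction {poly L}} :=
  if n is m.+1 then
    let a : {fraction {poly L}} := tofrac 'X in
    let C (z : L) : {fraction {poly L}} := tofrac z%:P in
    (a + C b) * (a + C c) * (a + C d) / (a + C b + C c + C d)
      * ratf_shift (wilson_moment b c d m) 1
    - a ^+ 2 * wilson_moment b c d m
  else 1.

Section FormalPowerSeries.

Variable L : fieldType.

(* A formal power series is given by its coefficients: f n = [t^n] f. *)
Definition fps := nat -> L.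

Implicit Types f g : fps.

Definition fps_one : fps := fun n => (n == 0)%:R.
Definition fps_t : fps := fun n => (n == 1)%:R.
Definition fps_scale (x : L) f : fps := fun n => x * f n.
Definition fps_mul f g : fps := fun n => \sum_(i < n.+1) f i * g (n - i)%N.
Definition fps_exp f (m : nat) : fps := iter m (fps_mul f) fps_one.

(* The sum of the family F, provided that t^i divides F i for every i; this is
   the case for all the families below as soon as f has no constant term. *)
Definition fps_sum (F : nat -> fps) : fps := fun n => \sum_(i < n.+1) F i n.

Definition fps_sin f : fps :=
  fps_sum (fun i =>
    fps_scale ((-1) ^+ i / ((2 * i).+1)`!%:R) (fps_exp f (2 * i).+1)).

Definition rising (x : L) (n : nat) : L := \prod_(i < n) (x + i%:R).

Definition fps_hypergeom (upper lower : seq L) f : fps :=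
  fps_sum (fun i =>
    fps_scale
      ((\prod_(x <- upper) rising x i)
         / ((\prod_(y <- lower) rising y i) * i`!%:R))
      (fps_exp f i)).

End FormalPowerSeries.

Arguments fps_t {L}.

(* Main.v *)
Require Import Defs.
From mathcomp Require Import all_boot all_order all_algebra.
From mathcomp Require Import mpoly ring.

Import GRing.Theory.

Set Implicit Arguments.
Unset Strict Implicit.
Unset Printing Implicit Defensive.

Local Open Scope ring_scope.

(** Iterating the contiguity recurrence expresses the moments as
    w_n(a) = sum_i c_{n,i}(a) (a+b)_i (a+c)_i (a+d)_i / (a+b+c+d)_i,
    where c_{n,i}(a) depends on a alone: every use of the first term of the
    recurrence shifts a and contributes one factor of the Pochhammer symbols,
    every use of the second one contributes the square of the current argument.
    Thus c_{n,i}(a) is, up to sign, the complete homogeneous symmetric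
    polynomial of degree n-i in a^2, (a+1)^2, ..., (a+i)^2. It satisfies
    c_{n+1,i}(a) = c_{n,i-1}(a) - (a+i)^2 c_{n,i}(a), whereas the moments call
    for the recurrence that removes the first variable a^2 instead of the last
    one; the two are reconciled by [central_coef_shift], which gives
    [wilson_value].

    It remains to identify, for every i, the generating function in n of
    c_{n,i}(a) for a = e/2 with e = 0 or 1:
    sum_n c_{n,i}(e/2) t^(2n+e)/(2n+e)! =
      2^e sin(t/2)^(2i+e) / ((e+1/2)_i i!).
    By the recurrence above, the left sides F_i solve F_i'' = F_{i-1} -
    (i+e/2)^2 F_i. The right sides solve the same system, because
    (s^m)'' = m(m-1)/4 s^(m-2) - m^2/4 s^m for s = sin(t/2), and the initial
    values agree ([sin_exp_ode], [sin_power_coef]). Summing over i gives both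
    hypergeometric series ([wilson_egf]).

    The moments have their poles at the zeros of a+b+c+d+j for natural j; for
    indeterminate b, c, d none of these is at 0 or 1/2, nor at their shifts by
    natural numbers ([sum_indet_neq0]). *)

(** * Values of the moments *)

Lemma cancel_den (F : fieldType) (x p q t : F) :
  t != 0 -> x * t * p / (q * t) = x * (p / q).
Proof.
move=> tn0; rewrite [q * t]mulrC -[x * t * p]mulrA -[LHS]mulrA -mulf_div.
by rewrite divff // mul1r.
Qed.

Section WilsonValues.

Variables (L : fieldType) (b c d : L).
Implicit Types (x : L) (n i : nat).

(** This is (-1)^(n-i) times the complete homogeneous symmetric polynomial of
    degree n-i in x^2, (x+1)^2, ..., (x+i)^2: up to sign, a central factorial
    number of the second kind when x = 0. The recurrence adjoins the last
    variable. *)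
Fixpoint central_coef x n i : L :=
  if n is m.+1 then
    (if i is j.+1 then central_coef x m j else 0)
      - (x + i%:R) ^+ 2 * central_coef x m i
  else (i == 0%N)%:R.

(** By symmetry the first variable x^2 may be split off instead of the last one;
    what remains are the variables of the shifted argument x + 1. This is the
    form that matches the contiguity recurrence of the moments. *)
Lemma central_coef_shift x n i :
  central_coef x n.+1 i =
    (if i is j.+1 then central_coef (x + 1) n j else 0)
      - x ^+ 2 * central_coef x n i.
Proof.
elim: n i => [|n IHn] i.
  by case: i => [|[|i]] /=; ring.
have E i' : central_coef x n.+2 i' =
    (if i' is j.+1 then central_coef x n.+1 j else 0)
      - (x + i'%:R) ^+ 2 * central_coef x n.+1 i' by [].
rewrite E [in X in _ - X]IHn.
case: i => [|i]; first by rewrite /=; ring.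
by rewrite IHn; case: i => [|i] /=; ring.
Qed.

Lemma risingS x n : rising x n.+1 = x * rising (x + 1) n.
Proof.
rewrite /rising big_ord_recl addr0; congr (_ * _); apply: eq_bigr => i _.
by rewrite -addrA -natr1 [1 + _]addrC.
Qed.

Lemma risingSr x n : rising x n.+1 = rising x n * (x + n%:R).
Proof. by rewrite /rising big_ord_recr. Qed.

Lemma rising_neq0 x n : (forall i, x + i%:R != 0) -> rising x n != 0.
Proof. by move=> x0; apply/prodf_neq0 => i _; apply: x0. Qed.

Let s := b + c + d.

(** The product that the factor (a+b)(a+c)(a+d)/(a+b+c+d) of the contiguity
    recurrence accumulates along i shifts of the argument. *)
Definition wilson_ratio x i : L :=
  rising (x + b) i * rising (x + c) i * rising (x + d) i / rising (x + s) i.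

(** Numerators over the explicit denominators [wilson_den]. The value of a
    fraction at a point is compatible with sums and shifts only away from the
    poles, so the moments are first put over denominators whose zeros are
    visible. *)
Fixpoint wilson_num n : {poly L} :=
  if n is m.+1 then
    ('X + b%:P) * ('X + c%:P) * ('X + d%:P) * (wilson_num m \Po ('X + 1%:P))
      - 'X ^+ 2 * ('X + s%:P + m%:R) * wilson_num m
  else 1.

Definition wilson_den n : {poly L} := \prod_(i < n) ('X + s%:P + i%:R).

Lemma wilson_denS n :
  wilson_den n.+1 = ('X + s%:P) * (wilson_den n \Po ('X + 1%:P)).
Proof.
rewrite /wilson_den big_ord_recl addr0 rmorph_prod; congr (_ * _).
apply: eq_bigr => i _; rewrite /= !rmorphD /= rmorph_nat !comp_polyC comp_polyX.
rewrite -[(bump 0 i)%:R]/(i.+1%:R) -natr1 polyC1; ring.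
Qed.

Lemma wilson_den_neq0 n : wilson_den n != 0.
Proof.
apply/prodf_neq0 => i _.
by rewrite -polyC_natr -addrA -polyCD -size_poly_eq0 size_XaddC.
Qed.

Lemma wilson_moment_frac n :
  wilson_moment b c d n = tofrac (wilson_num n) / tofrac (wilson_den n).
Proof.
elim: n => [|n IHn].
  by rewrite /= /wilson_den big_ord0 tofrac1 divr1.
have q1 : tofrac (wilson_den n.+1) != 0 by rewrite tofrac_eq0 wilson_den_neq0.
have E : tofrac (wilson_den n.+1) =
    tofrac (wilson_den n) * tofrac ('X + s%:P + n%:R).
  by rewrite -tofracM /wilson_den big_ord_recr.
have t0 : tofrac ('X + s%:P + n%:R) != 0.
  by move: q1; rewrite E mulf_eq0 negb_or => /andP[].
have -> : wilson_moment b c d n.+1 =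
    (tofrac 'X + tofrac b%:P) * (tofrac 'X + tofrac c%:P)
      * (tofrac 'X + tofrac d%:P)
      / (tofrac 'X + tofrac b%:P + tofrac c%:P + tofrac d%:P)
      * ratf_shift (wilson_moment b c d n) 1
    - tofrac 'X ^+ 2 * wilson_moment b c d n by [].
rewrite IHn ratf_shiftE ?wilson_den_neq0 //.
have -> : tofrac 'X + tofrac b%:P + tofrac c%:P + tofrac d%:P
    = tofrac ('X + s%:P) :> {fraction {poly L}}.
  by rewrite /s !polyCD !tofracD !addrA.
have -> : tofrac (wilson_num n.+1) =
    tofrac ('X + b%:P) * tofrac ('X + c%:P) * tofrac ('X + d%:P)
      * tofrac (wilson_num n \Po ('X + 1%:P))
    - tofrac 'X ^+ 2 * tofrac ('X + s%:P + n%:R) * tofrac (wilson_num n).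
  by rewrite /= tofracB !tofracM.
rewrite -!tofracD mulrBl [in LHS]mulf_div.
congr (_ - _); last by rewrite E cancel_den.
by rewrite -[X in _ / X = _]tofracM -wilson_denS.
Qed.

Lemma wilson_denE x n : (wilson_den n).[x] = rising (x + s) n.
Proof.
rewrite horner_prod; apply: eq_bigr => i _.
by rewrite -polyC_natr !hornerE.
Qed.

(** No [wilson_den n] vanishes at a point satisfying this condition, nor at its
    shifts by natural numbers. *)
Definition regular x := forall i, x + s + i%:R != 0.

Lemma regularS x : regular x -> regular (x + 1).
Proof.
by move=> rx i; have := rx i.+1; rewrite -natr1; congr (_ != 0); ring.
Qed.

Lemma wilson_ratioS x i :
  wilson_ratio x i.+1 = (x + b) * (x + c) * (x + d) / (x + s)
    * wilson_ratio (x + 1) i.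
Proof.
rewrite /wilson_ratio !risingS !(addrAC x _ 1) mulf_div; congr (_ / _); ring.
Qed.

Lemma wilson_valueS x n : regular x ->
  ratf_value (wilson_moment b c d n.+1) x =
    (x + b) * (x + c) * (x + d) / (x + s)
      * ratf_value (wilson_moment b c d n) (x + 1)
    - x ^+ 2 * ratf_value (wilson_moment b c d n) x.
Proof.
move=> rx; have rx1 := regularS rx.
have rise0 y m : regular y -> (wilson_den m).[y] != 0.
  by move=> ry; rewrite wilson_denE rising_neq0.
rewrite !wilson_moment_frac !ratf_valueE ?rise0 //.
have denS1 : (wilson_den n.+1).[x] = (x + s) * (wilson_den n).[x + 1].
  by rewrite wilson_denS hornerM horner_comp !hornerE.
have denS2 : (wilson_den n.+1).[x] = (wilson_den n).[x] * (x + s + n%:R).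
  by rewrite !wilson_denE risingSr.
have -> : (wilson_num n.+1).[x] =
    (x + b) * (x + c) * (x + d) * (wilson_num n).[x + 1]
      - x ^+ 2 * (x + s + n%:R) * (wilson_num n).[x].
  by rewrite /= -polyC_natr !hornerE horner_comp !hornerE.
have := rise0 _ n.+1 rx; rewrite denS2 mulf_eq0 negb_or => /andP[q0 t0].
rewrite mulrBl -{1}denS2 denS1; congr (_ - _); first by rewrite mulf_div.
by rewrite cancel_den.
Qed.

(** Unfolding the recurrence n times, each step either multiplies by the factor
    and shifts the argument, or multiplies by - a^2. The steps of the first kind
    produce the ratio, and the sum over the positions of the other steps is the
    coefficient: this is [central_coef_shift]. *)
Lemma wilson_value x n m : regular x -> (n < m)%N ->
  ratf_value (wilson_moment b c d n) x =
    \sum_(i < m) central_coef x n i * wilson_ratio x i.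
Proof.
elim: n x m => [|n IHn] x [|m] // rx lt_nm.
  rewrite wilson_moment_frac ratf_valueE wilson_denE ?rising_neq0 //.
  rewrite /rising /= big_ord0 hornerC divr1 big_ord_recl big1 => [|i _].
    rewrite /wilson_ratio /rising !big_ord0 /= !mul1r invr1 addr0 //.
  by rewrite /= mul0r.
rewrite wilson_valueS // (IHn _ m) ?(IHn x m.+1) //;
  [|exact: ltnW|exact: regularS].
under [RHS]eq_bigr do rewrite central_coef_shift mulrBl.
rewrite sumrB; congr (_ - _); last first.
  by rewrite mulr_sumr; apply: eq_bigr => i _; rewrite mulrA.
rewrite big_ord_recl mul0r add0r mulr_sumr; apply: eq_bigr => i _.
by rewrite wilson_ratioS mulrCA.
Qed.

End WilsonValues.

(** * Truncation of power series *)

Section Truncation.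

Variable L : fieldType.
Implicit Types (f g : fps L) (p q : {poly L}) (n m N : nat).

(** Identities between power series are checked one coefficient at a time, so a
    series may be replaced by a polynomial with the same first coefficients; the
    ring structure and the derivation of polynomials then become available. *)
Definition agree N p f := forall n, (n <= N)%N -> p`_n = f n.

Lemma agree_poly N f : agree N (\poly_(i < N.+1) f i) f.
Proof. by move=> n le_nN; rewrite coef_poly ltnS le_nN. Qed.

Lemma agree_mul N p q f g :
  agree N p f -> agree N q g -> agree N (p * q) (fps_mul f g).
Proof.
move=> pf qg n le_nN; rewrite coefM /fps_mul; apply: eq_bigr => i _.
rewrite pf ?qg //; first exact: leq_trans (leq_subr _ _) le_nN.
by apply: leq_trans le_nN; rewrite -ltnS.
Qed.

Lemma agree_exp N p f m : agree N p f -> agree N (p ^+ m) (fps_exp f m).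
Proof.
move=> pf; elim: m => [|m IHm]; first by move=> n _; rewrite coef1.
by rewrite exprS; apply: agree_mul.
Qed.

Lemma agree_scale N p f x : agree N p f -> agree N (x *: p) (fps_scale x f).
Proof. by move=> pf n le_nN; rewrite coefZ pf. Qed.

Lemma fps_exp_t m n : fps_exp (@fps_t L) m n = (n == m)%:R.
Proof.
rewrite -(@agree_exp n 'X) ?coefXn // => i _; by rewrite coefX.
Qed.

Lemma coef_exp_small p m n : p`_0 = 0 -> (n < m)%N -> (p ^+ m)`_n = 0.
Proof.
move=> p0 lt_nm; have /dvdpP[q ->] : 'X %| p.
  by rewrite -[ 'X ]subr0 -polyC0 dvdp_XsubCl /root horner_coef0 p0.
by rewrite exprMn coefMXn lt_nm.
Qed.

Lemma coef_exp_diag p m : p`_0 = 0 -> (p ^+ m)`_m = p`_1 ^+ m.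
Proof.
move=> p0; have /dvdpP[q ->] : 'X %| p.
  by rewrite -[ 'X ]subr0 -polyC0 dvdp_XsubCl /root horner_coef0 p0.
rewrite exprMn coefMXn ltnn subnn coefMX /= -!horner_coef0 horner_exp.
by [].
Qed.

End Truncation.

(** * Powers of the sine *)

Section Sine.

Variable L : fieldType.
Hypothesis L0 : [pchar L] =i pred0.
Local Notation half := (2%:R^-1 : L).

Definition sin_half : fps L := fps_sin (fps_scale half fps_t).

Lemma natr_neq0 n : (n.+1)%:R != 0 :> L.
Proof. by have /pcharf0P-> := L0. Qed.

Lemma sin_halfE n :
  sin_half n = (odd n)%:R * (-1) ^+ n./2 * half ^+ n / n`!%:R.
Proof.
have expE m : fps_exp (fps_scale half fps_t) m n = half ^+ m * (n == m)%:R.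
  have A : agree n (half *: 'X) (fps_scale half fps_t).
    by apply: agree_scale => i _; rewrite coefX.
  by rewrite -(agree_exp _ A) // exprZn coefZ coefXn.
rewrite /sin_half /fps_sin /fps_sum /fps_scale.
under eq_bigr do rewrite expE.
have [on|en] := boolP (odd n); last first.
  rewrite big1 ?mul0r // => i _; case: eqP => [E|_]; last by rewrite !mulr0.
  by move/negP: en; case; rewrite [in odd _]E /= mul2n odd_double.
have nE : n = (2 * n./2).+1 by rewrite -[LHS]odd_double_half on mul2n.
have lt : (n./2 < n.+1)%N.
  by rewrite ltnS -{2}[n]odd_double_half -addnn addnCA leq_addr.
rewrite (bigD1 (Ordinal lt)) //= big1 => [|i ne].
  by rewrite -nE eqxx mulr1 addr0 mul1r mulrAC.
case: eqP => [E|_]; last by rewrite !mulr0.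
have /eqP : (2 * i).+1 = (2 * n./2).+1 by rewrite -E -nE.
by rewrite eqSS eqn_mul2l /= => /eqP Ei; case/eqP: ne; apply: val_inj.
Qed.

Lemma sin_half_ode n :
  (n.+2 * n.+1)%:R * sin_half n.+2 = - (half ^+ 2 * sin_half n).
Proof.
rewrite !sin_halfE /= negbK 2!factS mulnA !natrM !exprS.
have := natr_neq0 n; have := natr_neq0 n.+1; have := natr_neq0 (n`!).-1.
rewrite prednK ?fact_gt0 // => h0 h1 h2.
move: (half) => r; field.
by rewrite h0 [1 + _]addrC [2 + _]addrC natr1 -natrD addn2 h1 h2.
Qed.

Definition sin_poly N : {poly L} := \poly_(i < N.+1) sin_half i.

Lemma sin_half0 : sin_half 0%N = 0.
Proof. by rewrite sin_halfE !mul0r. Qed.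

Lemma sin_half1 : sin_half 1%N = half.
Proof. by rewrite sin_halfE /= expr0 !mul1r divr1. Qed.

Lemma coef0_mulXn (p : {poly L}) N :
  (forall n, (n < N)%N -> p`_n = 0) -> exists q, p = q * 'X^N.
Proof.
move=> p0; exists (drop_poly N p); rewrite -[LHS](poly_take_drop N).
rewrite [take_poly N p](_ : _ = 0) ?add0r //.
by apply/polyP => i; rewrite coef_take_poly coef0; case: ifP => // /p0.
Qed.

Lemma sin_poly_ode N : exists u,
  (sin_poly N.+2)^`(2) = - (half ^+ 2 *: sin_poly N.+2) + u * 'X^(N.+1).
Proof.
have /coef0_mulXn[u uE] : forall n, (n < N.+1)%N ->
    ((sin_poly N.+2)^`(2) + half ^+ 2 *: sin_poly N.+2)`_n = 0.
  move=> n lt; rewrite coefD coefZ coef_derivn !coef_poly addnC /=.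
  have le : (n <= N)%N by [].
  rewrite addn2 !ltnS le (leq_trans le) ?leqW // ffactnS /= ffactn1.
  by rewrite -(mulr_natl (sin_half _)) sin_half_ode addNr.
by exists u; rewrite -uE addrC addrK.
Qed.

(** Pythagoras' identity, with the cosine of t/2 written as twice the derivative
    of the sine: the difference of the two sides has a derivative that vanishes
    to order N+1 by [sin_poly_ode], and no constant term. *)
Lemma sin_poly_pyth N : exists u,
  (sin_poly N.+2)^`() ^+ 2 =
    (half ^+ 2)%:P * (1 - sin_poly N.+2 ^+ 2) + u * 'X^(N.+1).
Proof.
set S := sin_poly _.
have [v vE] := sin_poly_ode N; rewrite -/S in vE.
set E := S^`() ^+ 2 + (half ^+ 2)%:P * S ^+ 2 - (half ^+ 2)%:P.
have dE : E^`() = 2%:R * S^`() * v * 'X^(N.+1).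
  rewrite /E !derivE.
  move: vE; rewrite derivSn derivn1 -mul_polyC => ->; ring.
have /coef0_mulXn[u uE] : forall n, (n < N.+1)%N -> E`_n = 0.
  case=> [|n] lt.
    rewrite /E coefB coefD coefCM coefC /= -!horner_coef0 !horner_exp.
    rewrite !horner_coef0.
    by rewrite coef_deriv !coef_poly /= sin_half0 sin_half1 expr0n
      mulr0 addr0 mulr1n subrr.
  have /eqP := coef_deriv E n; rewrite dE coefMXn (ltnW lt) eq_sym.
  by rewrite -mulr_natr mulf_eq0 (negPf (natr_neq0 n)) orbF => /eqP.
by exists u; rewrite -uE /E; ring.
Qed.

(** The coefficient form of the equation
    (s^m)'' = (m (m-1) s^(m-2) - m^2 s^m) / 4 for s = sin(t/2), which follows
    from s'' = - s/4 and s'^2 = (1 - s^2)/4. The truncated predecessors are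
    harmless: m (m-1) = 0 when m < 2. *)
Lemma sin_exp_ode N m n : (n <= N)%N ->
  (n.+2 * n.+1)%:R * (sin_poly N.+2 ^+ m)`_n.+2 =
    half ^+ 2 * ((m * m.-1)%:R * (sin_poly N.+2 ^+ m.-2)`_n
      - (m ^ 2)%:R * (sin_poly N.+2 ^+ m)`_n).
Proof.
move=> le; have [v vE] := sin_poly_ode N; have [u uE] := sin_poly_pyth N.
set S := sin_poly _ in vE uE *.
have -> : (n.+2 * n.+1)%:R * (S ^+ m)`_n.+2 = ((S ^+ m)^`(2))`_n.
  by rewrite coef_derivn addnC addn2 ffactnS ffactn1 mulr_natl.
have [w ->] : exists w, (S ^+ m)^`(2) =
    (half ^+ 2)%:P * ((m * m.-1)%:R * S ^+ m.-2 - (m ^ 2)%:R * S ^+ m)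
      + w * 'X^(N.+1).
  have dd : S^`()^`() = S^`(2) by [].
  case: m => [|[|m]].
  - by exists 0; rewrite derivSn derivn1 expr0 !derivE !mul0n exp0n //
      mulr0n !mul0r subrr mulr0 addr0.
  - by exists v; rewrite expr1 vE -mul_polyC mulr0n mul0r sub0r mul1r mulrN.
  exists (m.+2%:R * S ^+ m.+1 * v + (m.+2 * m.+1)%:R * S ^+ m * u).
  rewrite derivSn derivn1 deriv_exp derivMn derivM deriv_exp /= dd vE.
  rewrite -mul_polyC -(mulr_natr _ m.+1) -[LHS]mulr_natr.
  rewrite natrM natrX -[m.+2%:R]natr1; move: uE.
  move: (half ^+ 2)%:P 'X^(N.+1) (m.+1%:R : {poly L}) S^`() => h X k D DE.
  transitivity ((k + 1) * k * S ^+ m * D ^+ 2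
    + (k + 1) * S ^+ m.+1 * (- (h * S) + v * X)); first by ring.
  rewrite DE !exprS; clear; move: (S ^+ m) (S : {poly L}) => q p; ring.
rewrite coefD coefMXn ltnS le addr0 coefCM coefB -!polyC_natr !coefCM.
by [].
Qed.

End Sine.

(** * Comparison of the two expansions *)

Section Expansion.
Variable L : fieldType.
Hypothesis L0 : [pchar L] =i pred0.
Local Notation half := (2%:R^-1 : L).
Implicit Types (e : bool) (n i N : nat).

(** The parameter e selects the series: e = 0 for the moments at a = 0 and the
    even powers of the sine, e = 1 for the moments at a = 1/2 and the odd
    powers. *)
Definition sin_power_den e i : L := rising (half + e%:R) i * i`!%:R.

(** The sine is odd, hence its powers have the parity of their exponent. *)
Lemma sin_power_parity e N n i : (~~ e + 2 * n <= N.+2)%N ->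
  (sin_poly L N.+2 ^+ (e + 2 * i))`_(~~ e + 2 * n) = 0.
Proof.
have S0 : (sin_poly L N.+2)`_0 = 0 by rewrite coef_poly sin_half0.
elim: n i => [|n IHn] i.
  case: i => [|i] _.
    by case: e => /=; rewrite ?expr1 ?expr0 ?coef1.
  by rewrite coef_exp_small // mulnS; case: e.
rewrite mulnS addnCA !add2n !ltnS => le.
have le2 : (~~ e + 2 * n <= N.+2)%N by rewrite !leqW.
apply/eqP; have := sin_exp_ode L0 (e + 2 * i) le; rewrite IHn //.
suff -> : ((e + 2 * i) * (e + 2 * i).-1)%:R
    * (sin_poly L N.+2 ^+ (e + 2 * i).-2)`_(~~ e + 2 * n) = 0 :> L.
  rewrite mulr0 subrr mulr0 => /eqP; rewrite mulf_eq0 mulnS.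
  by have /pcharf0P -> := L0.
case: i => [|i]; first by case: (e); rewrite /= ?muln0 mul0r.
by rewrite mulnS addnCA IHn // mulr0.
Qed.

(** The two sides obey the same recurrence in n. With m = e + 2i one has
    m^2/4 = (e/2 + i)^2, which is the multiplier of [central_coef], and
    m(m-1)/4 = i (i + e - 1/2), which is the quotient of two successive values
    of [sin_power_den]; the latter uses that e is 0 or 1. *)
Lemma sin_power_coef e N n i : (e + 2 * n <= N.+2)%N ->
  (sin_poly L N.+2 ^+ (e + 2 * i))`_(e + 2 * n) =
    half ^+ e * sin_power_den e i * central_coef (half *+ e) n i
      / (e + 2 * n)`!%:R.
Proof.
have S0 : (sin_poly L N.+2)`_0 = 0 by rewrite coef_poly sin_half0.
have S1 : (sin_poly L N.+2)`_1 = half by rewrite coef_poly sin_half1.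
have nz m : m.+1%:R != 0 :> L by apply: natr_neq0.
have two : 2%:R != 0 :> L by apply: nz.
elim: n i => [|n IHn] i.
  case: i => [|i] _; last first.
    rewrite coef_exp_small // ?mulr0 ?mul0r //.
    by rewrite mulnS; case: e.
  rewrite !muln0 addn0 coef_exp_diag // S1.
  rewrite /sin_power_den /rising big_ord0 /= fact0.
  by rewrite !mulr1; case: e; rewrite divr1.
rewrite [(2 * n.+1)%N]mulnS addnCA !add2n !ltnS => le.
have le2 : (e + 2 * n <= N.+2)%N by rewrite !leqW.
have := sin_exp_ode L0 (e + 2 * i) le; rewrite IHn //.
have F0 : (e + 2 * n)`!%:R != 0 :> L by rewrite -(prednK (fact_gt0 _)) nz.
have E0 : ((e + 2 * n).+2 * (e + 2 * n).+1)%:R != 0 :> L.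
  by rewrite natrM mulf_neq0.
move=> eqS; apply: (mulfI E0); rewrite {}eqS; rewrite 2!factS mulnA.
rewrite [(_ * (e + 2 * n)`!)%:R]natrM invfM; move: F0 E0.
set F := (e + 2 * n)`!%:R; set E := ((e + 2 * n).+2 * _)%:R.
move=> F0 E0.
rewrite [RHS]mulrCA [X in _ = _ * X]mulrA divff // mul1r.
rewrite natrX natrD [(2 * i)%:R]natrM.
case: i => [|i].
  rewrite (_ : (_ * _.-1)%N = 0%N); last by case: (e).
  move: two F0; rewrite /=; move: F (central_coef _ n 0) => F' K two F0.
  by case: (e) => /=; field; rewrite ?F0 ?two.
rewrite (_ : (e + 2 * i.+1).-2 = (e + 2 * i)%N); last by rewrite mulnS addnCA.
rewrite IHn // /sin_power_den risingSr factS.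
rewrite (_ : (e + 2 * i.+1).-1 = (e + 2 * i).+1); last by rewrite mulnS addnCA.
have -> : central_coef (half *+ e) n.+1 i.+1 = central_coef (half *+ e) n i
    - (half *+ e + i.+1%:R) ^+ 2 * central_coef (half *+ e) n i.+1 by [].
rewrite !natrM -/F -[(e + 2 * i).+1%:R]natr1 !natrD !natrM -(natr1 i).
move: F0; move: F (central_coef _ n i) (central_coef _ n i.+1) (rising _ i).
move: i`!%:R i%:R => f k F' K K' R F0.
by case: (e) => /=; field; rewrite F0 two.
Qed.

Lemma fps_sum_even_odd e (F : nat -> L) N :
  fps_sum (fun n => fps_scale (F n) (fps_exp fps_t (e + 2 * n))) N =
    if odd N == e then F N./2 else 0.
Proof.
rewrite /fps_sum /fps_scale; under eq_bigr do rewrite fps_exp_t.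
have oddE n : odd (e + 2 * n) = e by rewrite oddD mul2n odd_double addbF oddb.
case: eqP => [eN|neN]; last first.
  rewrite big1 // => i _; case: eqP => [E|]; last by rewrite mulr0.
  by case: neN; rewrite E oddE.
have lt : (N./2 < N.+1)%N.
  by rewrite ltnS -{2}[N]odd_double_half -addnn addnCA leq_addr.
have NE : N = (e + 2 * N./2)%N by rewrite mul2n -eN odd_double_half.
rewrite (bigD1 (Ordinal lt)) //= -NE eqxx mulr1 big1 ?addr0 // => i ne.
case: eqP => [E|]; last by rewrite mulr0.
case/eqP: ne; apply: val_inj => /=.
have /eqP : (e + 2 * i = e + 2 * N./2)%N by rewrite -E.
by rewrite eqn_add2l eqn_mul2l => /eqP.
Qed.

Lemma sin_power_den_neq0 e i : sin_power_den e i != 0.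
Proof.
rewrite mulf_neq0 //; last by rewrite -(prednK (fact_gt0 _)) natr_neq0.
apply: rising_neq0 => j; rewrite -addrA -natrD.
have two : 2%:R != 0 :> L by apply: natr_neq0.
suff : half * (1 + 2 * (e + j))%:R != 0.
  by rewrite natrD natrM mulrDr mulr1 mulKf.
by rewrite mulf_neq0 ?invr_eq0 ?natr_neq0.
Qed.

(** Both hypergeometric identities at once, read on the coefficient of t^N. The
    power 2^e is the factor 2 in front of the sine in the second identity. *)
Lemma wilson_egf (b c d : L) e N : regular b c d (half *+ e) ->
  fps_sum (fun n => fps_scale
      (ratf_value (wilson_moment b c d n) (half *+ e) / (e + 2 * n)`!%:R)
      (fps_exp fps_t (e + 2 * n))) N =
  \sum_(i < N.+1) 2%:R ^+ e
    * (wilson_ratio b c d (half *+ e) i / sin_power_den e i)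
    * (sin_poly L N.+2 ^+ (e + 2 * i))`_N.
Proof.
move=> reg; rewrite fps_sum_even_odd.
case: eqP => [eN|neN]; last first.
  have NE : N = (~~ e + 2 * N./2)%N.
    by rewrite mul2n -{1}[N]odd_double_half; case: (e) (odd N) neN => [] [].
  rewrite big1 // => i _; rewrite [X in _`_X]NE sin_power_parity ?mulr0 //.
  by rewrite -NE leqW.
have NE : N = (e + 2 * N./2)%N by rewrite mul2n -eN odd_double_half.
have lt : (N./2 < N.+1)%N.
  by rewrite ltnS -{2}[N]odd_double_half -addnn addnCA leq_addr.
rewrite (wilson_value reg lt) mulr_suml; apply: eq_bigr => i _.
rewrite [X in _`_X]NE sin_power_coef -?NE ?leqW //.
have two : 2%:R != 0 :> L by apply: natr_neq0.
have F0 : N`!%:R != 0 :> L by rewrite -(prednK (fact_gt0 _)) natr_neq0.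
have := sin_power_den_neq0 e i.
move: (sin_power_den e i) (wilson_ratio _ _ _ _ _) => G W G0.
move: (central_coef _ _ _) => K.
by case: (e) => /=; field; rewrite ?G0 ?two F0.
Qed.

(** The number of terms in the coefficient of t^n grows with n; it can be taken
    uniform for n <= N because the powers p^i with i > n do not contribute. *)
Lemma agree_hypergeom (upper lower : seq L) (p : {poly L}) f N :
  p`_0 = 0 -> agree N p f ->
  agree N (\sum_(i < N.+1) ((\prod_(x <- upper) rising x i)
         / ((\prod_(y <- lower) rising y i) * i`!%:R)) *: p ^+ i)
     (fps_hypergeom upper lower f).
Proof.
move=> p0 pf n le_nN; rewrite coef_sum /fps_hypergeom /fps_sum /fps_scale.
rewrite (big_ord_widen N.+1
  (fun i => (\prod_(x <- upper) rising x i)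
         / ((\prod_(y <- lower) rising y i) * i`!%:R) * fps_exp f i n)) //.
rewrite [RHS]big_mkcond; apply: eq_bigr => i _; rewrite coefZ.
case: ltnP => [_|lt_ni]; first by rewrite (agree_exp _ pf).
by rewrite coef_exp_small ?mulr0.
Qed.

Lemma agree_sin N : agree N (sin_poly L N.+2) (sin_half L).
Proof. by move=> n le; rewrite agree_poly ?leqW. Qed.

Lemma wilson_egf0 (b c d : L) : regular b c d 0 ->
  fps_sum (fun n => fps_scale
      (ratf_value (wilson_moment b c d n) 0 / (2 * n)`!%:R)
      (fps_exp fps_t (2 * n)))
  =1 fps_hypergeom [:: b; c; d] [:: b + c + d; half] (fps_exp (sin_half L) 2).
Proof.
move=> reg N; have := @wilson_egf b c d false N reg; rewrite /= => ->.
have S0 : (sin_poly L N.+2)`_0 = 0 by rewrite coef_poly sin_half0.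
have A2 := agree_exp 2 (@agree_sin N).
have p0 : (sin_poly L N.+2 ^+ 2)`_0 = 0 by rewrite coef_exp_small.
rewrite -(agree_hypergeom _ _ p0 A2) // coef_sum; apply: eq_bigr => i _.
rewrite coefZ -exprM; congr (_ * _).
rewrite !big_cons !big_nil /wilson_ratio /sin_power_den.
by rewrite expr0 mul1r !add0r !addr0 !mulr1 -[LHS]mulrA -invfM !mulrA.
Qed.

Lemma wilson_egf1 (b c d : L) : regular b c d half ->
  fps_sum (fun n => fps_scale
      (ratf_value (wilson_moment b c d n) half / ((2 * n).+1)`!%:R)
      (fps_exp fps_t (2 * n).+1))
  =1 fps_mul (fps_scale 2%:R (sin_half L))
       (fps_hypergeom [:: b + half; c + half; d + half]
          [:: b + c + d + half; 3%:R / 2%:R] (fps_exp (sin_half L) 2)).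
Proof.
move=> reg N; have := @wilson_egf b c d true N reg; rewrite /= => ->.
have S0 : (sin_poly L N.+2)`_0 = 0 by rewrite coef_poly sin_half0.
have A1 := @agree_sin N; have A2 := agree_exp 2 A1.
have p0 : (sin_poly L N.+2 ^+ 2)`_0 = 0 by rewrite coef_exp_small.
rewrite -(agree_mul (agree_scale _ A1) (agree_hypergeom _ _ p0 A2)) //.
rewrite mulr_sumr coef_sum; apply: eq_bigr => i _.
rewrite -scalerAl -scalerAr !coefZ -exprM -exprS [RHS]mulrA expr1.
congr (_ * _ * _).
have two : 2%:R != 0 :> L by apply: natr_neq0.
have -> : 3%:R / 2%:R = half + 1 by field.
rewrite !big_cons !big_nil /wilson_ratio /sin_power_den !mulr1.
by rewrite mulr1n -[LHS]mulrA -invfM !(addrC half) !mulrA.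
Qed.

End Expansion.

(** * The generic parameters *)

(** The coefficient of the first indeterminate is m+1, nonzero in
    characteristic 0. *)
Lemma sum_indet_neq0 (k : fieldType) (k_char0 : [pchar k] =i pred0) m n :
  (('X_(inord 0) + 'X_(inord 1) + 'X_(inord 2)) *+ m.+1 + n%:R
     : {mpoly k[3]}) != 0.
Proof.
apply/eqP => /(congr1 (mcoeff U_(inord 0))).
rewrite mcoeff0 mcoeffD mcoeffMn !mcoeffD !mcoeffX.
have ne i j : (i <= 2)%N -> (j <= 2)%N -> i != j ->
    (inord i == inord j :> 'I_3) = false.
  by move=> i2 j2 /negPf ij; rewrite -val_eqE /= !inordK.
(* The constant n%:R does not contribute to a monomial of degree 1. *)
rewrite !eq_mnm1 eqxx !ne // !addr0 mcoeffMn mcoeff1 mnm1_eq0 mul0rn addr0.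
by move/eqP; have /pcharf0P -> := k_char0.
Qed.

Theorem theorem6 (k : fieldType) (k_char0 : [pchar k] =i pred0) :
  let L : fieldType := {fraction {mpoly k[3]}} in
  let b : L := tofrac 'X_(inord 0) in
  let c : L := tofrac 'X_(inord 1) in
  let d : L := tofrac 'X_(inord 2) in
  let w : nat -> {fraction {poly L}} := wilson_moment b c d in
  let half : L := 2%:R^-1 in
  let sin_half_t : fps L := fps_sin (fps_scale half fps_t) in
  (fps_sum (fun n =>
     fps_scale (ratf_value (w n) 0 / (2 * n)`!%:R) (fps_exp fps_t (2 * n)))
   =1 fps_hypergeom [:: b; c; d] [:: b + c + d; half] (fps_exp sin_half_t 2))
  /\
  (fps_sum (fun n =>
     fps_scale (ratf_value (w n) half / ((2 * n).+1)`!%:R)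
       (fps_exp fps_t (2 * n).+1))
   =1 fps_mul (fps_scale 2%:R sin_half_t)
        (fps_hypergeom [:: b + half; c + half; d + half]
           [:: b + c + d + half; 3%:R / 2%:R] (fps_exp sin_half_t 2))).
Proof.
move=> L b c d w half sin_half_t.
have L0 : [pchar L] =i pred0.
  apply/pcharf0P => n; have /pcharf0P <- := k_char0.
  rewrite -(rmorph_nat (@tofrac {mpoly k[3]})) tofrac_eq0.
  by rewrite -mpolyC_nat mpolyC_eq0.
have sum_neq0 m n : (b + c + d) *+ m.+1 + n%:R != 0.
  have := sum_indet_neq0 k_char0 m n.
  by rewrite -tofrac_eq0 tofracD tofracMn !tofracD rmorph_nat.
split.
  apply: wilson_egf0 => // i.
  by have := sum_neq0 0 i; rewrite mulr1n add0r.
apply: wilson_egf1 => // i.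
have two : 2%:R != 0 :> L by apply: natr_neq0.
(* Clearing the fraction 1/2 turns the required inequality into m = 1. *)
have := sum_neq0 1 (1 + 2 * i)%N; apply: contra_neq => E.
have -> : (b + c + d) *+ 2 + (1 + 2 * i)%:R =
    2%:R * (half + (b + c + d) + i%:R).
  by rewrite natrD natrM /half; field.
by rewrite E mulr0.
Qed.
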